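(* Let $\mathbb{F}$ be a field, let $G$ be a finite group, let $n\ge 1$, and let $\rho : G \to \mathrm{GL}(\mathbb{F}^n)$ be an irreducible representation. Then for every $h \in G$ and every $\lambda \in \mathbb{F}$ such that $\rho(h) \neq \lambda \mathbf{I}$ we have $$\operatorname{rank}(\rho(h) - \lambda\mathbf{I}) \;\geq\; \frac{\theta_{\mathbb{F}} \cdot \gamma_h \cdot n}{2\log_2 (2|G|)}.$$
   Context: $\mathbf{I}$ is the $n\times n$ identity matrix and $|G|$ is the order of $G$. The constant $\theta_{\mathbb{F}}$ is defined by $\theta_{\mathbb{F}} = 1$ if $\mathbb{F}$ is infinite, and $\theta_{\mathbb{F}} = 1 - \frac{1}{|\mathbb{F}|}$ if $\mathbb{F}$ is finite. For $h\in G$ with order $\mathrm{ord}(h)$ in $G$, the constant $\gamma_h$ is defined by $\gamma_h = 1$ if $\mathrm{ord}(h)$ is even, and $\gamma_h = 1 - \frac{1}{\mathrm{ord}(h)}$ if $\mathrm{ord}(h)$ is odd. *)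

(* Defs.v *)
From HB Require Import structures.
From mathcomp Require Import all_boot all_order all_algebra all_fingroup.
From mathcomp Require Import mxrepresentation.
From mathcomp Require Import finmap boolp classical_sets functions cardinality.
From mathcomp Require Import reals exp.

Set Implicit Arguments.
Unset Strict Implicit.
Unset Printing Implicit Defensive.

Import Order.TTheory GRing.Theory Num.Theory.
Local Open Scope ring_scope.
Local Open Scope classical_set_scope.

Definition log2 (R : realType) (x : R) : R := ln x / ln 2.

(* [F] is an arbitrary field, not a [finFieldType], so its finiteness is
   decided classically; [fset_set] enumerates [[set: F]] when it is finite. *)
Definition theta (R : realType) (F : fieldType) : R :=
  if `[< finite_set [set: F] >] then 1 - (#|` fset_set [set: F]|%:R)^-1 else 1.

Definition gamma (R : realType) (gT : finGroupType) (h : gT) : R :=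
  if odd #[h]%g then 1 - (#[h]%g%:R)^-1 else 1.

(* Main.v *)
Require Import Defs.
From HB Require Import structures.
From mathcomp Require Import all_boot all_order all_algebra all_fingroup.
From mathcomp Require Import commutator mxrepresentation.
From mathcomp Require Import reals exp.

Set Implicit Arguments.
Unset Strict Implicit.
Unset Printing Implicit Defensive.

Import Order.TTheory GRing.Theory Num.Theory.
Local Open Scope ring_scope.

(** The commutators [[~ h, g]], for [g] in [G], generate a subgroup [M] that
    [G] normalizes, and each of them is close to acting trivially:
    [rho [~ h, g] - 1] is [rho (g h)^-1] times the additive commutator of
    [rho h - lambda] and [rho g], hence has rank at most [2 r], where
    [r = \rank (rho h - lambda)] ([rank_repr_commg]).  The space of vectors
    fixed by [M] is a [G]-submodule, hence zero or everything.

    If it is zero: [M] is generated by some [k <= log2 #|G|] of the commutators,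
    because each generator that is not redundant at least doubles the order
    ([small_generating_subset]), and the space fixed by [k] elements that each
    act as the identity up to rank [2 r] has codimension at most [2 r k]
    ([codim_rfix_mx]).  So [n <= 2 r k].

    If it is everything: [rho h] commutes with [rho G], so by Schur's lemma the
    nonzero matrix [rho h - lambda] is invertible, and [r = n].

    In both cases [n <= 2 r log2 (2 #|G|)], which implies the theorem because
    [theta] and [gamma] lie in the unit interval. *)

(** A subset [B] of [A] that is maximal with [2 ^ #|B| <= #|<<B>>|] generates:
    another element [x] of [A] outside [<<B>>] could be added, since [<<B>>] has
    index at least 2 in [<<x |: B>>]. *)
Lemma small_generating_subset (gT : finGroupType) (A : {set gT}) :
  exists2 B : {set gT}, B \subset A &
    (<<B>> = <<A>> /\ 2 ^ #|B| <= #|<<A>>|)%g%N.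
Proof.
pose P (B : {set gT}) := (B \subset A) && (2 ^ #|B| <= #|<<B>>|)%g%N.
have P0 : P set0 by rewrite /P sub0set cards0 cardG_gt0.
have [B /maxsetP[/andP[sBA leB] maxB] _] := maxset_exists P0.
suff defB : (<<B>> = <<A>>)%g by exists B => //; split; rewrite -?defB.
apply/eqP; rewrite eqEsubset genS //= gen_subG.
apply/subsetP=> x Ax; apply: contraT => notBx.
have notBx' : x \notin B by apply: contra notBx; apply: mem_gen.
have PxB : P (x |: B).
  rewrite /P subUset sub1set Ax sBA /= cardsU1 notBx' add1n expnS mulnC.
  have sBxB : (<<B>> \subset <<x |: B>>)%g by rewrite genS // subsetUr.
  rewrite -(Lagrange sBxB) leq_mul // indexg_gt1.
  by apply: contra notBx => /subsetP-> //; rewrite mem_gen // setU11.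
by rewrite -(maxB _ PxB (subsetUr _ _)) setU11 in notBx'.
Qed.

(** The space fixed by [B] is the intersection of the kernels of the matrices
    [rG x - 1] for [x] in [B], each of codimension at most [d]. *)
Lemma codim_rfix_mx (F : fieldType) (gT : finGroupType) (G : {group gT})
    (n : nat) (rG : mx_representation F G n) (B : {set gT}) (d : nat) :
    {in B, forall x, (\rank (rG x - 1%:M)%R <= d)%N} ->
  (n <= \rank (rfix_mx rG B) + #|B| * d)%N.
Proof.
have [m] := ubnP #|B|; elim: m B => // m IHm B ltBm rkB.
have [->|[x Bx]] := set_0Vmem B.
  suff /mxrankS : (1%:M <= rfix_mx rG set0)%MS.
    by rewrite mxrank1 => /leq_trans-> //; rewrite leq_addr.
  by apply/rfix_mxP=> x; rewrite inE.
set B' := B :\ x; set K := kermx (rG x - 1%:M).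
have cardB : #|B| = #|B'|.+1 by rewrite (cardsD1 x B) Bx.
have /IHm/(_ _) IH : (#|B'| < m)%N by rewrite -ltnS -cardB.
have {IH} := IH (fun y B'y => rkB y (subsetP (subsetDl _ _) y B'y)).
have sCapB : (rfix_mx rG B' :&: K <= rfix_mx rG B)%MS.
  apply/rfix_mxP=> y By; have [-> | neq_yx] := eqVneq y x.
    apply/eqP; rewrite -subr_eq0 -[X in _ - X]mulmx1 -mulmxBr.
    by apply/eqP/sub_kermxP/capmxSr.
  by apply: (rfix_mxP B' (capmxSl _ K)); rewrite !inE neq_yx.
have rkK : (n <= \rank K + d)%N.
  by rewrite mxrank_ker -leq_subLR subKn ?rank_leq_row ?rkB.
have := mxrankS sCapB; have := mxrank_sum_cap (rfix_mx rG B') K.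
have := rank_leq_col (rfix_mx rG B' + K)%MS.
move: rkK; rewrite cardB mulSn.
move: (\rank K) (\rank (_ + _)%MS) (\rank (_ :&: _)%MS) (\rank (rfix_mx _ B')).
move: (\rank _) (#|B'| * d)%N => f c k s i b.
move=> le_n_kd le_s_n eq_sum le_i_f le_n_bc.
rewrite -(leq_add2l n) (leq_trans (leq_add le_n_kd le_n_bc)) //.
rewrite [(k + d + _)%N]addnACA [(k + b)%N]addnC -eq_sum -addnA.
by rewrite leq_add // leq_add.
Qed.

(** With [X = rho h - lambda], the difference [rho [~ h, g] - 1] equals
    [rho (h^-1 g^-1) * (X * rho g - rho g * X)], because scalars commute with
    [rho g]. *)
Lemma rank_repr_commg (F : fieldType) (gT : finGroupType) (G : {group gT})
    (n : nat) (rG : mx_representation F G n) (h g : gT) (lambda : F) :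
    h \in G -> g \in G ->
  (\rank (rG [~ h, g]%g - 1%:M)%R <= 2 * \rank (rG h - lambda%:M)%R)%N.
Proof.
move=> Gh Gg; set X := rG h - lambda%:M.
have -> : rG [~ h, g]%g - 1%:M
    = rG (h^-1 * g^-1)%g *m (X *m rG g - rG g *m X).
  have -> : X *m rG g - rG g *m X = rG h *m rG g - rG g *m rG h.
    by rewrite mulmxBl mulmxBr scalar_mxC opprB addrA subrK.
  rewrite mulmxBr -!repr_mxM ?groupM ?groupV // -(repr_mx1 rG).
  by congr (rG _ - rG _); rewrite ?commgEl ?conjgE !mulgA ?mulgKV ?mulVg.
apply: leq_trans (mxrankM_maxr _ _) _; apply: leq_trans (mxrank_add _ _) _.
by rewrite mxrank_opp mul2n -addnn leq_add ?mxrankM_maxl ?mxrankM_maxr.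
Qed.

Lemma centgmx_commg (F : fieldType) (gT : finGroupType) (G : {group gT})
    (n : nat) (rG : mx_representation F G n) (h : gT) :
  h \in G -> {in G, forall g, rG [~ h, g]%g = 1%:M} -> centgmx rG (rG h).
Proof.
move=> Gh triv; apply/centgmxP=> g Gg.
rewrite -[LHS]repr_mxM // (commgC h g) repr_mxM ?groupR ?groupM // triv //.
by rewrite mulmx1 repr_mxM.
Qed.

(** If the commutators of [h] act nontrivially, [k] is the number of them that
    generate [[~: [set h], G]], and even [2 ^ k <= #|G|].  If they act
    trivially, the rank is [n] and [k = 1] works; the factor 2 in front of
    [#|G|] makes room for this when [G] is trivial. *)
Lemma irr_dim_le_rank (F : fieldType) (gT : finGroupType) (G : {group gT})
    (n : nat) (rG : mx_representation F G n) (h : gT) (lambda : F) :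
    mx_irreducible rG -> h \in G -> rG h <> lambda%:M ->
  exists2 k, (2 ^ k <= 2 * #|G|)%N & (n <= 2 * \rank (rG h - lambda%:M)%R * k)%N.
Proof.
move=> irrG Gh /eqP neq_h; set r := \rank _.
have [_ simG] := (mx_irrP rG).1 irrG.
set M := [~: [set h], G]%g.
have sMG : M \subset G.
  rewrite gen_subG; apply/subsetP=> _ /imset2P[_ g /set1P-> Gg ->].
  by rewrite groupR.
have nsMG : (M <| G)%g by rewrite /normal sMG commg_normr.
have comM g : g \in G -> [~ h, g]%g \in M.
  by move=> Gg; rewrite mem_commg ?set11.
have [fix0 | nz_fix] := eqVneq (rfix_mx rG M) 0; last first.
  have full := simG _ (normal_rfix_mx_module rG nsMG) nz_fix.
  exists 1%N; first by rewrite leq_pmulr.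
  have cGh : centgmx rG (rG h - lambda%:M).
    apply/centgmxP=> g Gg; rewrite mulmxBl mulmxBr scalar_mxC; congr (_ - _).
    move: g Gg; apply/centgmxP/centgmx_commg => // g Gg.
    have /rfix_mxP/(_ _ (comM g Gg)) : (1%:M <= rfix_mx rG M)%MS by rewrite sub1mx.
    by rewrite mul1mx.
  have := mx_Schur irrG cGh; rewrite subr_eq0 => /(_ neq_h)/mxrank_unit rk_n.
  by rewrite muln1 /r rk_n leq_pmull.
have [B sB [genB leB]] := small_generating_subset (commg_set [set h] G).
exists #|B|.
  by rewrite (leq_trans leB) // (leq_trans (subset_leq_card sMG)) // leq_pmull.
have fixB : rfix_mx rG B = 0.
  apply/eqP; rewrite -submx0 -fix0 -rfix_mx_rstabC // /M /commutator -genB.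
  rewrite gen_subG rfix_mx_rstabC //.
  by apply: subset_trans sMG; apply: subset_trans sB _; apply: subset_gen.
suff : (n <= \rank (rfix_mx rG B) + #|B| * (2 * r))%N.
  by rewrite fixB mxrank0 mulnC.
apply: codim_rfix_mx => x /(subsetP sB)/imset2P[_ g /set1P-> Gg ->].
exact: rank_repr_commg.
Qed.

Lemma subr1_natV_itv (R : realType) (m : nat) :
  0 <= 1 - (m%:R : R)^-1 <= 1.
Proof.
rewrite subr_ge0 gerBl invr_ge0 ler0n andbT.
by case: m => [|m]; rewrite ?invr0 ?ler01 // invf_le1 ?ltr0n // ler1n.
Qed.

Theorem mainTheorem2 (R : realType) (F : fieldType) (gT : finGroupType)
    (G : {group gT}) (n : nat) (n_ge1 : (1 <= n)%N)
    (rho : mx_representation F G n) (rho_irr : mx_irreducible rho)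
    (h : gT) (hG : h \in G) (lambda : F) (rho_h : rho h <> lambda%:M) :
  (\rank (rho h - lambda%:M))%:R >=
    theta R F * gamma R h * n%:R / (2 * log2 (2 * #|G|%:R)).
Proof.
have /andP[theta_ge0 theta_le1] : 0 <= theta R F <= 1.
  by rewrite /theta; case: ifP; rewrite ?subr1_natV_itv ?ler01 ?lexx.
have /andP[gamma_ge0 gamma_le1] : 0 <= gamma R h <= 1.
  by rewrite /gamma; case: ifP; rewrite ?subr1_natV_itv ?ler01 ?lexx.
have ln2_gt0 : 0 < ln 2 :> R by rewrite ln_gt0 // ltr1n.
have G2_gt1 : 1 < 2 * #|G|%:R :> R.
  by rewrite -natrM ltr1n (@leq_mul 2 1) ?cardG_gt0.
have log_gt0 : 0 < log2 (2 * #|G|%:R) :> R by rewrite /log2 divr_gt0 // ln_gt0.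
have [k le_k le_n] := irr_dim_le_rank rho_irr hG rho_h.
have k_le_log : k%:R <= log2 (2 * #|G|%:R) :> R.
  have G2_gt0 := lt_trans ltr01 G2_gt1.
  rewrite ler_pdivlMr // [leLHS]mulr_natl -lnXn // ler_ln ?posrE ?exprn_gt0 //.
  by rewrite -natrX -natrM ler_nat.
rewrite ler_pdivrMr; last by apply: mulr_gt0; rewrite ?ltr0n.
apply: (@le_trans _ _ (n%:R : R)).
  by rewrite ler_piMl ?ler0n // mulr_ile1.
apply: (@le_trans _ _ ((2 * \rank (rho h - lambda%:M)%R * k)%N%:R : R)).
  by rewrite ler_nat.
by rewrite !natrM mulrA [2 * _]mulrC ler_wpM2l ?mulr_ge0 ?ler0n.
Qed.
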